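(* For every $n\ge 1$ and every $L\in\mathfrak B^n$, the circulant matrices over $\mathbb F_2$ satisfy $C(L)\,C(L)=C(\mathfrak b*L)$.
   Context: $\mathfrak B^n=\{0,1\}^n$ is regarded as the vector space $\mathbb F_2^n$; vectors are indexed $L=[L_0,\dots,L_{n-1}]$ and indices are taken modulo $n$. The cyclic right shift is $\sigma*[a_0,\dots,a_{n-1}]=[a_{n-1},a_0,\dots,a_{n-2}]$. The circulant $C(L)$ is the $n\times n$ matrix over $\mathbb F_2$ whose rows are, from top to bottom, $L,\sigma*L,\dots,\sigma^{n-1}*L$; i.e. $C(L)_{i,j}=L_{j-i \bmod n}$ for $0\le i,j\le n-1$. The discrete baker transformation $\mathfrak b:\mathfrak B^n\to\mathfrak B^n$ is defined by $(\mathfrak b*L)_i=\bigoplus_{j\in\{0,\dots,n-1\}:\ 2j\equiv i\ (\mathrm{mod}\ n)}L_j$ (sum in $\mathbb F_2$, an empty sum being $0$). *)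

(* Defs.v *)
From mathcomp Require Import all_boot all_order all_algebra.

Set Implicit Arguments.
Unset Strict Implicit.
Unset Printing Implicit Defensive.

Import GRing.Theory.
Local Open Scope ring_scope.

(* B^n = {0,1}^n, seen as F_2^n, is the type 'rV['F_2]_n; L_i is L 0 i. *)

(* [a_0, ..., a_(n-1)] |-> [a_(n-1), a_0, ..., a_(n-2)]; ord_pred is the
   predecessor modulo n. *)
Definition cshift (n : nat) (L : 'rV['F_2]_n) : 'rV['F_2]_n :=
  \row_(i < n) L 0 (ord_pred i).

Definition circulant (n : nat) (L : 'rV['F_2]_n) : 'M['F_2]_n :=
  \matrix_(i < n) iter i (@cshift n) L.

Definition baker (n : nat) (L : 'rV['F_2]_n) : 'rV['F_2]_n :=
  \row_(i < n) \sum_(j < n | (2 * j == i %[mod n])%N) L 0 j.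

(* C(L)_(i,j) = L_(j - i mod n). *)
Lemma circulantE (n : nat) (L : 'rV['F_2]_n) (i j k : 'I_n) :
  (i + k = j %[mod n])%N -> circulant L i j = L 0 k.
Proof.
rewrite !mxE; move: (nat_of_ord i) => m {i}.
elim: m j => [|m IHm] j /=.
  by rewrite add0n !modn_small // => /val_inj->.
move=> e; rewrite mxE; apply: IHm => /=.
rewrite modn_mod; apply/eqP; rewrite -(eqn_modDr 1) !addn1 -addSn; apply/eqP.
have n_gt0 : (0 < n)%N by apply: leq_ltn_trans (ltn_ord j).
by rewrite e prednK ?modnDr // addn_gt0 n_gt0 orbT.
Qed.

(* Main.v *)
(* Writing d = j - i, the (i, j) entry of C(L)^2 is the sum over m of
   L_m L_(d-m).  The involution m |-> d - m pairs equal terms, which cancel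
   over F_2; only its fixed points 2m = d survive, each contributing
   L_m^2 = L_m. *)
Require Import Defs.
From mathcomp Require Import all_boot all_order all_algebra.

Local Open Scope ring_scope.

Import GRing.Theory.

Lemma sum_involution_pchar2 (R : nzRingType) (I : finType) (h : I -> I)
    (F : I -> R) :
  2%N \in [pchar R] -> involutive h -> (forall x, F (h x) = F x) ->
  \sum_x F x = \sum_(x | h x == x) F x.
Proof.
move=> R2 hK Fh; rewrite (bigID (fun x => h x == x)) /=.
rewrite [X in _ + X](bigID (fun x => enum_rank x < enum_rank (h x))%N) /=.
rewrite [X in _ + (_ + X)](reindex_inj (inv_inj hK)) /=.
rewrite [X in _ + (_ + X)](eq_big (fun x =>
  (h x != x) && (enum_rank x < enum_rank (h x))%N) F) => [||x _] //.
  by rewrite (addrr_pchar2 R2) addr0.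
move=> x; rewrite hK eq_sym; case: eqP => //= /eqP hx.
rewrite -leqNgt leq_eqVlt; case: eqP => // /val_inj/enum_rank_inj xh.
by rewrite -xh eqxx in hx.
Qed.

(** Since ['I_n.+1] is the additive group of integers modulo [n.+1], the congruence can be solved by
    subtraction. *)
Lemma circulant_subE (n : nat) (L : 'rV['F_2]_n.+1) (i j : 'I_n.+1) :
  circulant L i j = L 0 (j - i).
Proof.
apply: circulantE; rewrite -[in RHS](subrK i j) addrC.
by rewrite addnC /= modn_mod.
Qed.

Lemma baker_addE (n : nat) (L : 'rV['F_2]_n.+1) (d : 'I_n.+1) :
  baker L 0 d = \sum_(m | m + m == d) L 0 m.
Proof.
rewrite mxE; apply: eq_bigl => m.
by rewrite -val_eqE /= mul2n -addnn (modn_small (ltn_ord d)).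
Qed.

Theorem lemma3 (n : nat) (hn : (1 <= n)%N) (L : 'rV['F_2]_n) :
  circulant L *m circulant L = circulant (baker L).
Proof.
case: n hn L => // n _ L; apply/matrixP=> i j.
(* Shifting the summation index by [i] turns the factors into [L 0 m] and [L 0 (j - i - m)]. *)
rewrite circulant_subE baker_addE mxE (reindex_inj (addIr i)) /=.
under eq_bigr => m _ do rewrite !circulant_subE addrK opprD addrCA [- m + _]addrC.
rewrite (@sum_involution_pchar2 _ _ (fun m => j - i - m)) ?pchar_Fp //.
- apply: eq_big => [m|m /eqP dm]; first by rewrite subr_eq eq_sym.
  (* Idempotence in F_2, checked on 0 and 1. *)
  by rewrite dm; case: (L 0 m) => [[|[|]]] // ?; apply/val_inj.
- exact: subKr.
- by move=> m; rewrite subKr mulrC.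
Qed.
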